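(* Let $P$ be any set of $n\geq 3$ points in general position in the plane, and let $D(P)$ be its edge disjointness graph. If the minimum degree of $D(P)$ satisfies $$\delta(D(P))=\binom{\lfloor\frac{n-2}{2}\rfloor}{2}+\binom{\lceil\frac{n-2}{2}\rceil}{2},$$ then $$\kappa(D(P))=\binom{\lfloor\frac{n-2}{2}\rfloor}{2}+\binom{\lceil\frac{n-2}{2}\rceil}{2}.$$
   Context: A point set in the plane is in general position if no three of its points are collinear. The edge disjointness graph $D(P)$ is the graph whose vertices are all the closed straight line segments $xy$ with distinct endpoints $x,y\in P$; two vertices are adjacent if and only if the corresponding segments are disjoint. $\delta(H)$ denotes the minimum degree of a graph $H$. A graph $H$ is $k$-connected ($k\ge 0$ an integer) if $|V(H)|>k$ and $H\setminus W$ is connected for every $W\subset V(H)$ with $|W|<k$. The connectivity $\kappa(H)$ is the greatest integer $k$ such that $H$ is $k$-connected, with $\kappa(H)=0$ if and only if $H$ is disconnected or $|V(H)|=1$. By convention $\binom{m}{2}=0$ if $m<2$. *)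

(* Defs.v *)
From mathcomp Require Import all_boot all_order all_algebra.
From mathcomp Require Import finmap boolp classical_sets reals.

Set Implicit Arguments.
Unset Strict Implicit.
Unset Printing Implicit Defensive.

Import Order.TTheory GRing.Theory Num.Theory.

Local Open Scope nat_scope.

Record sgraph := SGraph {
  vertex :> finType;
  adj : rel vertex;
  adj_sym : symmetric adj;
  adj_irrefl : irreflexive adj
}.

Section Graphs.
Variable G : sgraph.

Definition degree (v : G) : nat := #|[set u : G | adj v u]|.

(* Degrees are smaller than #|G|, so the default value of the minimum is only
   reached by the graph with no vertices. *)
Definition min_degree : nat := \big[minn/#|G|]_(v : G) degree v.

Definition connected : bool :=
  [forall u : G, forall v : G, connect (@adj G) u v].

End Graphs.

Section Connectivity.
Variables (G : sgraph) (W : {set G}).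

Definition del_adj : rel {v : G | v \notin W} :=
  fun u v => adj (val u) (val v).

Lemma del_adj_sym : symmetric del_adj.
Proof. by move=> u v; exact: adj_sym. Qed.

Lemma del_adj_irrefl : irreflexive del_adj.
Proof. by move=> u; exact: adj_irrefl. Qed.

Definition delete : sgraph := SGraph del_adj_sym del_adj_irrefl.

End Connectivity.

Definition k_connected (G : sgraph) (k : nat) : bool :=
  (k < #|G|) && [forall W : {set G}, (#|W| < k) ==> connected (delete W)].

(* A k-connected graph has more than k vertices, so the range k < #|G| is no
   restriction. *)
Definition connectivity (G : sgraph) : nat :=
  \max_(k < #|G| | k_connected G k) k.

Lemma min_degree_le (G : sgraph) (v : G) : min_degree G <= degree v.
Proof.
rewrite /min_degree; have := mem_index_enum v.
elim: (index_enum G) => // u r IH; rewrite inE big_cons => /predU1P[->|/IH].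
  exact: geq_minl.
exact/leq_trans/geq_minr.
Qed.

Lemma min_degree_attained (G : sgraph) :
  0 < #|G| -> exists v : G, degree v = min_degree G.
Proof.
case/card_gt0P=> v0 _.
have : min_degree G = #|G| \/ exists v : G, degree v = min_degree G.
  rewrite /min_degree; elim/big_rec: _ => [|v d _ IH]; first by left.
  rewrite /minn; case: ifP => _; first by right; exists v.
  exact: IH.
case=> // eqG; have := min_degree_le v0; rewrite eqG leqNgt => /negP[].
rewrite /degree -cardsT; apply/proper_card/properP; split; first exact: finset.subsetT.
by exists v0; rewrite ?inE ?adj_irrefl.
Qed.

Lemma k_connected_le (G : sgraph) k : k_connected G k -> k <= connectivity G.
Proof.
move=> kG; have kltG : k < #|G| by case/andP: kG.
exact: (@leq_bigmax_cond _ (fun i : 'I_#|G| => k_connected G i)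
          (fun i => i : nat) (Ordinal kltG)).
Qed.

Lemma k_connected_connectivity (G : sgraph) :
  0 < #|G| -> k_connected G (connectivity G).
Proof.
move=> G0; rewrite /connectivity; apply: (big_ind (k_connected G)) => //.
- by rewrite /k_connected G0; apply/forallP.
- by move=> i j Gi Gj; rewrite maxnC /maxn; case: ifP.
Qed.

Section Plane.
Variable R : realType.

Local Notation plane := 'rV[R]_2.

Local Open Scope ring_scope.
Local Open Scope classical_set_scope.

Definition line (a v : plane) : set plane := [set a + t *: v | t in [set: R]].

Definition collinear (x y z : plane) : Prop :=
  exists a v : plane, [/\ v != 0, line a v x, line a v y & line a v z].

Definition segment (x y : plane) : set plane :=
  [set (1 - t) *: x + t *: y | t in [set t : R | 0 <= t <= 1]].

Definition general_position (P : {fset plane}) : Prop :=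
  forall x y z : plane, x \in P -> y \in P -> z \in P ->
    x != y -> x != z -> y != z -> ~ collinear x y z.

Definition segments (P : {fset plane}) : {fset (set plane)} :=
  [fset segment x y | x in P, y in P & x != y]%fset.

Lemma segment_left (x y : plane) : segment x y x.
Proof. by exists 0; rewrite /= ?lexx ?ler01 // subr0 scale1r scale0r addr0. Qed.

Section EdgeDisjointnessGraph.
Variable P : {fset plane}.

Definition disjoint_segments : rel (segments P) :=
  fun s t => `[< fsval s `&` fsval t = set0 >].

Lemma disjoint_segments_sym : symmetric disjoint_segments.
Proof. by move=> s t; rewrite /disjoint_segments setIC. Qed.

Lemma disjoint_segments_irrefl : irreflexive disjoint_segments.
Proof.
move=> [s sP]; apply/negbTE/asboolPn; rewrite /= setIid => s0.
case/imfset2P: sP => x _ [y _ sE].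
by have := segment_left x y; rewrite -sE s0.
Qed.

Definition edge_disjointness_graph : sgraph :=
  SGraph disjoint_segments_sym disjoint_segments_irrefl.

End EdgeDisjointnessGraph.

End Plane.

(* Main.v *)
Require Import Defs.
From mathcomp Require Import all_boot all_order all_algebra.
From mathcomp Require Import zify ring lra.

(* A separating set W splits the other segments into two nonempty classes such
   that segments of different classes meet; colour the pairs of points
   accordingly. With m = n - 2 it suffices to show that at most
   2 m + 1 + m^2 / 4 pairs (rounded down) are coloured. If x and y have at most
   two common coloured neighbours, then at most n + 1 coloured pairs contain x
   or y, which is the growth of the bound from n - 2 to n: delete x and y, and
   use induction. (If one colour disappears, all remaining pairs cross the line
   of a single deleted segment, hence form a bipartite graph.)

   To find x and y, call a point pure if all its coloured pairs have the same
   colour. Two points pure in opposite colours have at most one common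
   neighbour. If all extreme points are pure in the same colour, take a segment
   ab of the other colour and extreme points x, y on the two sides of the line
   ab: the segments at x and y all meet ab, so that a and b are the only
   possible common neighbours. Finally, around an extreme point u that is not
   pure, the other points are linearly ordered by angle, the coloured pairs
   become intervals, and intervals of different colours intersect; x and y are
   chosen among u and the first and last neighbours of u in each colour, except
   when one colour occurs once at u and the other at least three times. *)

Set Implicit Arguments.
Unset Strict Implicit.
Unset Printing Implicit Defensive.

Import Order.TTheory GRing.Theory Num.Theory.
Local Open Scope ring_scope.

(** * Point sets with two colours of pairwise meeting segments *)

Section CodegreeTwo.
Variables (R : realFieldType) (T : finType) (px py : T -> R).

Implicit Types (S : {set T}) (u x y : T).

Definition orient (a b c : T) : R :=
  (px b - px a) * (py c - py a) - (py b - py a) * (px c - px a).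

Lemma orient_aba a b : orient a b a = 0. Proof. rewrite /orient; ring. Qed.
Lemma orient_abb a b : orient a b b = 0. Proof. rewrite /orient; ring. Qed.
Lemma orient_baC a b c : orient b a c = - orient a b c.
Proof. rewrite /orient; ring. Qed.
Lemma orient_acbC a b c : orient a c b = - orient a b c.
Proof. rewrite /orient; ring. Qed.

Hypothesis pt_inj : forall a b, px a = px b -> py a = py b -> a = b.
Hypothesis gen_pos :
  forall a b c, a != b -> a != c -> b != c -> orient a b c != 0.

Variable e : bool -> rel T.
Hypothesis e_sym : forall c, symmetric (e c).
Hypothesis e_irr : forall c, irreflexive (e c).
Hypothesis e_excl : forall c x y, e c x y -> e (~~ c) x y -> False.
(** All that is kept of two segments meeting: no line through two points separates them, one of them
    being allowed to touch it. *)
Hypothesis e_sep : forall c a b x y z w, e c x y -> e (~~ c) z w -> a != b ->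
  orient a b x <= 0 -> orient a b y <= 0 ->
  0 < orient a b z -> 0 < orient a b w -> False.

Definition coloured x y := e true x y || e false x y.

Lemma colouredE c x y : coloured x y = e c x y || e (~~ c) x y.
Proof. by case: c => //=; rewrite /coloured orbC. Qed.

Lemma coloured_sym : symmetric coloured.
Proof. by move=> x y; rewrite /coloured !(e_sym _ x). Qed.

Lemma coloured_irr : irreflexive coloured.
Proof. by move=> x; rewrite /coloured !e_irr. Qed.

Lemma e_neq c x y : e c x y -> x != y.
Proof. by move=> h; apply/eqP => E; move: h; rewrite E e_irr. Qed.

(** The line [a b], used in both directions, has [a] and [b] on its closed sides, so [x] and [y] are
    not both strictly on one side. *)
Lemma straddle c a b x y : e c a b -> e (~~ c) x y ->
  x != a -> x != b -> y != a -> y != b -> orient a b x * orient a b y < 0.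
Proof.
move=> hc hc' xa xb ya yb; have ab := e_neq hc.
have ox : orient a b x != 0 by rewrite gen_pos // eq_sym.
have oy : orient a b y != 0 by rewrite gen_pos // eq_sym.
have h1 := e_sep hc hc' ab; have ba : b != a by rewrite eq_sym.
have h2 := e_sep hc hc' ba; move: h1 h2.
rewrite !orient_aba !orient_abb !(orient_baC a b x) !(orient_baC a b y) lexx !oppr_gt0.
case: (ltgtP (orient a b x) 0) ox => // hx _;
case: (ltgtP (orient a b y) 0) oy => // hy _ h1 h2.
- by case: (h2).
- by rewrite nmulr_rlt0.
- by rewrite pmulr_rlt0.
- by case: (h1).
Qed.

(** * Pure points and low codegree *)

Definition nbr (S : {set T}) x := [set y in S | coloured x y].

Definition low_codegree (S : {set T}) :=
  exists x y, [/\ x \in S, y \in S, x != y & (#|nbr S x :&: nbr S y| <= 2)%N].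

(** A point with no coloured pair in [S] is pure in both colours. *)
Definition pure (S : {set T}) c x := [forall y in S, ~~ e (~~ c) x y].

Lemma in_nbr_pure (S : {set T}) c x y : pure S c x -> y \in nbr S x -> e c x y.
Proof.
move=> /forall_inP px0; rewrite inE (colouredE c) => /andP[yS /orP[]//].
by move/negP: (px0 y yS).
Qed.

(* [u x], [u y] in one colour and [v x], [v y] in the other would make both
   [u x v y] and [u y v x] pairs of crossing segments, against the
   Grassmann-Pluecker relation. *)
Lemma pure_low_codegree (S : {set T}) c u v : u \in S -> v \in S -> u != v ->
  pure S c u -> pure S (~~ c) v -> low_codegree S.
Proof.
move=> uS vS uv pu pv; exists u, v; split => //.
rewrite (@leq_trans 1) //; apply/card_le1_eqP => x y.
rewrite !in_setI => /andP[/(in_nbr_pure pu) ux /(in_nbr_pure pv) vx].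
move=> /andP[/(in_nbr_pure pu) uy /(in_nbr_pure pv) vy].
apply/eqP/negPn/negP => yx.
have nux := e_neq ux; have nxu : x != u by rewrite eq_sym.
have nuy := e_neq uy; have nyu : y != u by rewrite eq_sym.
have nvx := e_neq vx; have nxv : x != v by rewrite eq_sym.
have nvy := e_neq vy; have nyv : y != v by rewrite eq_sym.
have vu : v != u by rewrite eq_sym.
have xy : x != y by rewrite eq_sym.
have := straddle ux vy vu nvx nyu yx.
have := straddle uy vx vu nvy nxu xy.
have vy' : e (~~ c) v y by [].
have ux' : e (~~ ~~ c) u x by rewrite negbK.
have uy' : e (~~ ~~ c) u y by rewrite negbK.
have := straddle vy ux' uv nuy nxv xy.
have := straddle vx uy' uv nux nyv yx.
have -> : orient u y v = - orient v y u by rewrite /orient; ring.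
have -> : orient u y x = - orient u x y by rewrite /orient; ring.
have -> : orient v x u = - orient u x v by rewrite /orient; ring.
have -> : orient v x y = - orient v y x by rewrite /orient; ring.
(* With the names below, [p] and [q] have one sign and [r] and [s] the other, so the terms of this
   area relation cannot cancel. *)
have : - orient v y x - orient u x y + orient v y u + orient u x v = 0.
  by rewrite /orient; ring.
rewrite !mulrNN.
move: (orient v y x) (orient u x y) (orient v y u) (orient u x v) => p q r s E.
by case: (ltrgt0P p); case: (ltrgt0P q); nra.
Qed.

(** Edges at [p] and at [q] that avoid [a] and [b] cross the line [a b], so they end on different
    sides of it. *)
Lemma edge_low_codegree (S : {set T}) c a b p q : e c a b ->
  p \in S -> q \in S -> pure S (~~ c) p -> pure S (~~ c) q ->
  0 < orient a b p -> orient a b q < 0 -> low_codegree S.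
Proof.
move=> ab pS qS pp pq op oq; exists p, q; split => //.
  by apply: contraTneq op => ->; rewrite -leNgt ltW.
apply: leq_trans (_ : #|[set a; b]| <= 2)%N; last by rewrite cards2; case: eqP.
apply/subset_leq_card/fintype.subsetP => y.
rewrite !in_setI => /andP[/(in_nbr_pure pp) py1 /(in_nbr_pure pq) qy].
rewrite !inE; apply/negPn; rewrite negb_or; apply/negP => /andP[ya yb].
have pa : p != a by apply: contraTneq op => ->; rewrite orient_aba ltxx.
have pb : p != b by apply: contraTneq op => ->; rewrite orient_abb ltxx.
have qa : q != a by apply: contraTneq oq => ->; rewrite orient_aba ltxx.
have qb : q != b by apply: contraTneq oq => ->; rewrite orient_abb ltxx.
have := straddle ab py1 pa pb ya yb; rewrite pmulr_rlt0 // => oy.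
have := straddle ab qy qa qb ya yb; rewrite nmulr_rlt0 //.
by rewrite ltNge ltW.
Qed.


Lemma low_codegreeI (S : {set T}) x y p q : x \in S -> y \in S -> x != y ->
  (forall w, w \in nbr S x -> w \in nbr S y -> w = p \/ w = q) ->
  low_codegree S.
Proof.
move=> xS yS xy h; exists x, y; split => //.
apply: leq_trans (_ : #|[set p; q]| <= 2)%N; last by rewrite cards2; case: eqP.
apply/subset_leq_card/fintype.subsetP => w; rewrite in_setI => /andP[wx wy].
by rewrite !inE; case: (h w wx wy) => ->; rewrite eqxx ?orbT.
Qed.

(** * Angular order around a point *)

Lemma exists_min d (I : orderType d) (A : {set T}) (i : T -> I) x0 : x0 \in A ->
  exists2 m, m \in A & forall x, x \in A -> (i m <= i x)%O.
Proof. by move=> x0A; case: (arg_minP i x0A) => m; exists m. Qed.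

(* [i] lists the points around [u] in angular order. An edge [x y] is read as
   the interval between [i x] and [i y], an edge [u t] as the point [i t]. *)
Definition angular (S : {set T}) u (i : T -> int) :=
  [/\ {in S :\ u &, injective i},
   forall c t x y, t \in S :\ u -> x \in S :\ u -> y \in S :\ u ->
     e c u t -> e (~~ c) x y ->
     (i x <= i t \/ i y <= i t) /\ (i t <= i x \/ i t <= i y) &
   forall c x y z w, x \in S :\ u -> y \in S :\ u -> z \in S :\ u ->
     w \in S :\ u -> e c x y -> e (~~ c) z w ->
     [\/ i z <= i x, i z <= i y, i w <= i x | i w <= i y]].

Lemma angularN S u i : angular S u i -> angular S u (fun x => - i x).
Proof.
move=> [inj pt iv]; split.
- by move=> x y xD yD /oppr_inj; exact: inj.
- move=> c t x y tD xD yD ut xy; have := pt c t x y tD xD yD ut xy.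
  by rewrite !lerN2; tauto.
- move=> c x y z w xD yD zD wD xy zw; rewrite !lerN2.
  have zw' : e (~~ ~~ (~~ c)) z w by rewrite negbK.
  have xy' : e (~~ ~~ c) x y by rewrite negbK.
  by case: (iv (~~ c) z w x y zD wD xD yD zw xy') => h;
    [apply: Or41|apply: Or43|apply: Or42|apply: Or44].
Qed.

(* The first and last neighbours of [u]: [r1], [r2] in colour [c] and [b1], [b2]
   in the other colour. *)
Record fan (S : {set T}) u (i : T -> int) c r1 r2 b1 b2 : Prop := Fan {
  fan_ang : angular S u i;
  fan_u : u \in S;
  fan_r1 : r1 \in S /\ e c u r1;
  fan_r2 : r2 \in S /\ e c u r2;
  fan_b1 : b1 \in S /\ e (~~ c) u b1;
  fan_b2 : b2 \in S /\ e (~~ c) u b2;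
  fan_r : forall t, t \in S -> e c u t -> i r1 <= i t <= i r2;
  fan_b : forall t, t \in S -> e (~~ c) u t -> i b1 <= i t <= i b2 }.

Lemma fanC S u i c r1 r2 b1 b2 :
  fan S u i c r1 r2 b1 b2 -> fan S u i (~~ c) b1 b2 r1 r2.
Proof. by case=> *; split => //; rewrite negbK. Qed.

Lemma fanN S u i c r1 r2 b1 b2 :
  fan S u i c r1 r2 b1 b2 -> fan S u (fun x => - i x) c r2 r1 b2 b1.
Proof.
case=> ang uS hr1 hr2 hb1 hb2 hr hb; split => //; first exact: angularN.
  by move=> t tS /(hr t tS); rewrite !lerN2 andbC.
by move=> t tS /(hb t tS); rewrite !lerN2 andbC.
Qed.

Lemma nbr_in S x y : y \in nbr S x -> y \in S.
Proof. by rewrite inE => /andP[]. Qed.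

Lemma in_D1 (S : {set T}) u t c : t \in S -> e c u t -> t \in S :\ u.
Proof. by move=> tS /e_neq; rewrite !inE eq_sym tS andbT. Qed.

(** The edge meets [u r1] and [u r2], so its interval covers both [r1] and [r2]. *)
Lemma fan_edge_b S u i c r1 r2 b1 b2 x y : fan S u i c r1 r2 b1 b2 ->
  x \in S :\ u -> y \in S :\ u -> e (~~ c) x y ->
  (i x <= i r1 \/ i y <= i r1) /\ (i r2 <= i x \/ i r2 <= i y).
Proof.
case=> -[_ pt _] _ [h1 u1] [h2 u2] _ _ _ _ xD yD xy.
have [a1 _] := pt _ _ _ _ (in_D1 h1 u1) xD yD u1 xy.
by have [_ a2] := pt _ _ _ _ (in_D1 h2 u2) xD yD u2 xy.
Qed.

Lemma fan_edge_r S u i c r1 r2 b1 b2 x y : fan S u i c r1 r2 b1 b2 ->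
  x \in S :\ u -> y \in S :\ u -> e c x y ->
  (i x <= i b1 \/ i y <= i b1) /\ (i b2 <= i x \/ i b2 <= i y).
Proof.
by move=> /fanC F xD yD xy; apply: (fan_edge_b F); rewrite ?negbK.
Qed.

Lemma fan_neq S u i c r1 r2 b1 b2 x y : fan S u i c r1 r2 b1 b2 ->
  x \in S -> e c u x -> y \in S -> e (~~ c) u y -> i x != i y.
Proof.
case=> -[inj _ _] _ _ _ _ _ _ _ xS ux yS uy; apply/eqP => /inj E.
have exy : x = y by apply: E; [exact: in_D1 ux|exact: in_D1 uy].
by subst y; apply: (@e_excl c u x).
Qed.

(** The weaker of the covering conditions of the two colours. *)
Lemma fan_edge S u i c r1 r2 b1 b2 x y : fan S u i c r1 r2 b1 b2 ->
  i r1 < i b1 -> x \in S :\ u -> y \in S :\ u -> coloured x y ->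
  (i x <= i b1 \/ i y <= i b1) /\
  (Num.min (i r2) (i b2) <= i x \/ Num.min (i r2) (i b2) <= i y).
Proof.
move=> F r1b1 xD yD; rewrite (colouredE c) => /orP[xy|xy].
  by move: (fan_edge_r F xD yD xy); clear; lia.
by move: (fan_edge_b F xD yD xy) r1b1; clear; lia.
Qed.

(** Besides [u], a common neighbour of [r1] and [r2] is not before [b1], by its edge to [r1], and
    not after it, by its edge to [r2]. *)
Lemma fan_interleaved S u i c r1 r2 b1 b2 : fan S u i c r1 r2 b1 b2 ->
  i r1 < i b1 -> i b1 <= i r2 -> low_codegree S.
Proof.
move=> F r1b1 b1r2; have [[inj _ _] uS [r1S ur1] [r2S ur2] [b1S ub1] [b2S ub2] _ hb] := F.
have /andP[_ b12] := hb b1 b1S ub1.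
have r1D := in_D1 r1S ur1; have r2D := in_D1 r2S ur2; have b1D := in_D1 b1S ub1.
have n := fan_neq F r2S ur2 b1S ub1.
apply: (@low_codegreeI _ r1 r2 u b1) => //.
  by apply/eqP => E; move: r1b1 b1r2; rewrite E; clear; lia.
move=> w; rewrite !inE => /andP[wS w1] /andP[_ w2].
have [->|wu] := eqVneq w u; [by left|right].
have wD : w \in S :\ u by rewrite !inE wu.
apply: inj => //.
move: n r1b1 b1r2 b12 (fan_edge F r1b1 r1D wD w1) (fan_edge F r1b1 r2D wD w2).
by clear; lia.
Qed.

(** If [u] has a neighbour [t] of the other colour strictly between [b1] and [b2], the pair is [t]
    and the first point around [u], sharing at most [u] and [r]; otherwise [u] and [r] share at most
    [b1] and [b2]. *)
Lemma fan_singleton S u i c r b1 b2 : fan S u i c r r b1 b2 ->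
  i r < i b1 -> low_codegree S.
Proof.
move=> F rb1; have [[inj _ _] uS [rS ur] _ [b1S ub1] [b2S ub2] hr hb] := F.
have rD := in_D1 rS ur; have b1D := in_D1 b1S ub1; have b2D := in_D1 b2S ub2.
have /andP[_ b12] := hb b1 b1S ub1.
case: (boolP [exists t in S, e (~~ c) u t && (i b1 < i t < i b2)]).
  case/existsP => t /and3P[tS ut /andP[b1t tb2]]; have tD := in_D1 tS ut.
  have [x xD hx] := exists_min i rD.
  have xr := hx r rD.
  have xS : x \in S by move: xD; rewrite !inE => /andP[].
  apply: (@low_codegreeI _ t x u r) => //.
    by apply/eqP => E; move: xr rb1 b1t; rewrite E; clear; lia.
  move=> w; rewrite !inE => /andP[wS w1] /andP[_ w2].
  have [->|wu] := eqVneq w u; [by left|right].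
  have wD : w \in S :\ u by rewrite !inE wu.
  apply: inj => //.
  have := fan_edge F rb1 xD wD w2; have xw := hx w wD.
  move: w1; rewrite (colouredE c) => /orP[tw|tw].
    by move: (fan_edge_r F tD wD tw) b1t tb2; clear; lia.
  by move: (fan_edge_b F tD wD tw) b1t xr xw rb1 b12; clear; lia.
move=> /existsPn none; apply: (@low_codegreeI _ u r b1 b2) => //.
  exact: e_neq ur.
move=> w; rewrite !inE => /andP[wS w1] /andP[_ w2].
move: w1; rewrite (colouredE c) => /orP[uw|uw].
  have wr : i w = i r by apply/eqP; rewrite eq_le andbC; exact: hr.
  have E := inj _ _ (in_D1 wS uw) rD wr; move: w2.
  by rewrite E coloured_irr.
have wD := in_D1 wS uw.
have := none w; rewrite wS uw /= => nw; have bw := hb w wS uw.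
have [E|E] : i w = i b1 \/ i w = i b2 by move: nw bw; clear; lia.
  by left; apply: inj.
by right; apply: inj.
Qed.

(** In the main case [r1 < r2 < b1 < b2] in the order. If [r2] has no edge of the other colour, [r2]
    and [b2] share only [u]; if [b1] has none of colour [c], so do [b1] and [r1]. *)
Lemma fan_separated S u i c r1 r2 b1 b2 : fan S u i c r1 r2 b1 b2 ->
  i r2 < i b1 -> low_codegree S.
Proof.
move=> F r2b1; have [[inj _ iv] uS [r1S ur1] [r2S ur2] [b1S ub1] [b2S ub2] hr hb] := F.
have r1D := in_D1 r1S ur1; have r2D := in_D1 r2S ur2.
have b1D := in_D1 b1S ub1; have b2D := in_D1 b2S ub2.
have /andP[_ r12] := hr r1 r1S ur1; have /andP[_ b12] := hb b1 b1S ub1.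
have [E|nr] := eqVneq (i r1) (i r2).
  have E' := inj _ _ r1D r2D E; subst r2.
  exact: fan_singleton F r2b1.
have [E|nb] := eqVneq (i b1) (i b2).
  have E' := inj _ _ b1D b2D E; subst b2.
  by apply: (fan_singleton (fanN (fanC F))); rewrite ltrN2.
have {}nr : i r1 < i r2 by rewrite lt_neqAle nr.
have {}nb : i b1 < i b2 by rewrite lt_neqAle nb.
have r1b1 := lt_trans nr r2b1.
case: (boolP [exists y in S :\ u, e c b1 y]) => [/exists_inP[y yD b1y]|/exists_inPn no].
  case: (boolP [exists x in S :\ u, e (~~ c) x r2]) => [/exists_inP[x xD xr2]|/exists_inPn no].
    (* [x r2] ends at [r2] and [b1 y] starts at [b1]: disjoint intervals of different colours. *)
    have b1y' : e (~~ ~~ c) b1 y by rewrite negbK.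
    move: (iv _ _ _ _ _ xD r2D b1D yD xr2 b1y') (fan_edge_b F xD r2D xr2).
    move: (fan_edge_r F b1D yD b1y) nr nb r2b1; clear => h1 h2 h3 h4 [];
      by move: h1 h2 h3 h4; lia.
  apply: (@low_codegreeI _ r2 b2 u u) => //.
    by apply/eqP => E; move: r2b1 nb; rewrite E; clear; lia.
  move=> w; rewrite !inE => /andP[wS w1] /andP[_ w2].
  have [->|wu] := eqVneq w u; [by left|exfalso].
  have wD : w \in S :\ u by rewrite !inE wu.
  move: w1; rewrite (colouredE c) => /orP[rw|].
    by move: nb r2b1 (fan_edge F r1b1 b2D wD w2) (fan_edge_r F r2D wD rw); clear; lia.
  by rewrite e_sym; apply/negP/no.
apply: (@low_codegreeI _ b1 r1 u u) => //.
  by apply/eqP => E; move: r1b1; rewrite E; clear; lia.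
move=> w; rewrite !inE => /andP[wS w1] /andP[_ w2].
have [->|wu] := eqVneq w u; [by left|exfalso].
have wD : w \in S :\ u by rewrite !inE wu.
move: w1; rewrite (colouredE c) => /orP[|bw]; first by apply/negP/no.
by move: nr nb r2b1 (fan_edge F r1b1 r1D wD w2) (fan_edge_b F b1D wD bw); clear; lia.
Qed.

Lemma angular_low_codegree (S : {set T}) u i : u \in S -> angular S u i ->
  ~~ pure S true u -> ~~ pure S false u -> low_codegree S.
Proof.
move=> uS ang /forall_inPn[b bS /negPn ub] /forall_inPn[r rS /negPn ur].
have ext c t : t \in S -> e c u t -> exists t1 t2, [/\ t1 \in S /\ e c u t1,
    t2 \in S /\ e c u t2 & forall x, x \in S -> e c u x -> i t1 <= i x <= i t2].
  move=> tS ut; have tA : t \in [set x in S | e c u x] by rewrite inE tS.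
  have [t1 + h1] := exists_min i tA; have [t2 + h2] := exists_min (fun x => - i x) tA.
  rewrite !inE => /andP[t2S ut2] /andP[t1S ut1]; exists t1, t2; split => // x xS ux.
  have xA : x \in [set x in S | e c u x] by rewrite inE xS.
  by have := h1 x xA; have := h2 x xA; rewrite lerN2 => -> ->.
have [r1 [r2 [hr1 hr2 hr]]] := ext _ _ rS ur.
have [b1 [b2 [hb1 hb2 hb]]] := ext _ _ bS ub.
have F : fan S u i true r1 r2 b1 b2 by [].
have n1 := fan_neq F hr1.1 hr1.2 hb1.1 hb1.2.
have n2 := fan_neq F hr2.1 hr2.2 hb1.1 hb1.2.
have n3 := fan_neq F hr1.1 hr1.2 hb2.1 hb2.2.
case: (ltgtP (i r1) (i b1)) n1 => // h _.
  case: (ltgtP (i r2) (i b1)) n2 => // h2 _; first exact: fan_separated F h2.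
  by apply: fan_interleaved F h (ltW h2).
case: (ltgtP (i b2) (i r1)) n3 => // h2 _; first exact: fan_separated (fanC F) h2.
by apply: fan_interleaved (fanC F) h (ltW h2).
Qed.


(** * Extreme points *)

(** [u] lies on a supporting line of [S] parallel to [a b]. *)
Definition extreme (S : {set T}) u :=
  exists a b, a != b /\ forall x, x \in S -> orient a b u <= orient a b x.

Lemma orient_neq u x y : 0 < orient u x y -> [/\ u != x, u != y & x != y].
Proof.
by move=> h; split; apply: contraTneq h => ->;
   rewrite ?orient_aba ?orient_abb /orient; lra.
Qed.

Lemma orient_trans S u x y z : extreme S u -> x \in S -> y \in S -> z \in S ->
  0 < orient u x y -> 0 < orient u y z -> 0 < orient u x z.
Proof.
case=> a [b [ab ext]] xS yS zS xy yz.
have [ux uy nxy] := orient_neq xy; have [_ uz nyz] := orient_neq yz.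
have nxz : x != z.
  by apply: contraTneq yz => <-; rewrite orient_acbC oppr_gt0 -leNgt ltW.
have hx := ext x xS; have hy := ext y yS; have hz := ext z zS.
(* Grassmann-Pluecker, with heights over the supporting line as nonnegative factors: if
   [orient u x z] is negative, [x] and [y] have height 0. *)
have plu : orient u x y * (orient a b z - orient a b u)
         + orient u y z * (orient a b x - orient a b u)
         = orient u x z * (orient a b y - orient a b u) by rewrite /orient; ring.
have := gen_pos ux uz nxz; case: ltgtP => // neg _.
have y0 : orient a b y = orient a b u by nra.
have x0 : orient a b x = orient a b u by nra.
(* If both heights vanish, these identities give [a = b]. *)
have dx : (px b - px a) * orient u x y =
  (orient a b y - orient a b u) * (px x - px u) - (orient a b x - orient a b u) * (px y - px u).
  by rewrite /orient; ring.
have dy : (py b - py a) * orient u x y =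
  (orient a b y - orient a b u) * (py x - py u) - (orient a b x - orient a b u) * (py y - py u).
  by rewrite /orient; ring.
move: dx dy; rewrite x0 y0 !subrr !mul0r subr0 => /eqP + /eqP.
rewrite !mulf_eq0 !(gt_eqF xy) !orbF !subr_eq0 => /eqP Ex /eqP Ey.
by case/eqP: ab; apply: pt_inj.
Qed.

Lemma extreme_angular S u : u \in S -> extreme S u -> exists i, angular S u i.
Proof.
(* The rank of [x] in the angular order. *)
move=> uS ext; pose i x := #|[set y in S | 0 < orient u y x]|%:Z.
have D t : t \in S :\ u -> t \in S /\ u != t.
  by rewrite !inE eq_sym => /andP[].
have mono x y : x \in S :\ u -> y \in S :\ u -> 0 < orient u x y -> i x < i y.
  move=> /D[xS _] /D[yS _] xy; rewrite ltz_nat; apply/proper_card/properP; split.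
    apply/fintype.subsetP => z; rewrite !inE => /andP[zS zx].
    by rewrite zS (orient_trans ext zS xS yS zx xy).
  by exists x; rewrite !inE xS // orient_abb ltxx.
have inj : {in S :\ u &, injective i}.
  move=> x y xD yD E; apply/eqP; apply: contraT => xy.
  have [[xS ux] [yS uy]] := (D x xD, D y yD).
  have := gen_pos ux uy xy; case: ltgtP => // h _.
    by have := mono y x yD xD; rewrite orient_acbC oppr_gt0 h E ltxx => /(_ isT).
  by have := mono x y xD yD h; rewrite E ltxx.
have monoI x y : x \in S :\ u -> y \in S :\ u -> i x < i y -> 0 < orient u x y.
  move=> xD yD lt; have [[xS ux] [yS uy]] := (D x xD, D y yD).
  have xy : x != y by apply: contraTneq lt => ->; rewrite ltxx.
  have := gen_pos ux uy xy; case: ltgtP => // h _.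
  by have := mono y x yD xD; rewrite orient_acbC oppr_gt0 h ltNge ltW // => /(_ isT).
have monoW x y : x \in S :\ u -> y \in S :\ u -> i x <= i y -> orient u y x <= 0.
  move=> xD yD; rewrite le_eqVlt => /predU1P[/inj ->//|/(monoI _ _ xD yD)].
    by rewrite orient_abb.
  by rewrite orient_acbC oppr_gt0 => /ltW.
exists i; split=> // [c t x y tD xD yD ut xy|c x y z w xD yD zD wD xy zw].
  (* An edge entirely after or before [t] would be separated from [u t] by the line [u t]. *)
  have [_ ntu] := D t tD; split.
    case: (leP (i x) (i t)) => [|tx]; [by left|right; rewrite leNgt; apply/negP => ty].
    by apply: (e_sep ut xy ntu); rewrite ?orient_aba ?orient_abb //; apply: monoI.
  case: (leP (i t) (i x)) => [|tx]; [by left|right; rewrite leNgt; apply/negP => ty].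
  have nut : t != u by rewrite eq_sym.
  by apply: (e_sep ut xy nut); rewrite ?orient_aba ?orient_abb //
    orient_baC -orient_acbC; apply: monoI.
case: (leP (i z) (i x)) => [|xz]; first by constructor 1.
case: (leP (i z) (i y)) => [|yz]; first by constructor 2.
case: (leP (i w) (i x)) => [|xw]; first by constructor 3.
case: (leP (i w) (i y)) => [|yw]; first by constructor 4.
exfalso; have [[_ ux] [_ uy]] := (D x xD, D y yD).
(* The line through [u] and the later of [x] and [y] separates the edges. *)
case: (leP (i x) (i y)) => [h|/ltW h].
  by apply: (e_sep xy zw uy); rewrite ?orient_abb //; [exact: monoW|exact: monoI|exact: monoI].
by apply: (e_sep xy zw ux); rewrite ?orient_abb //; [exact: monoW|exact: monoI|exact: monoI].
Qed.

Lemma extreme_low_codegree S u c : u \in S -> extreme S u ->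
  [\/ low_codegree S, pure S c u | pure S (~~ c) u].
Proof.
move=> uS ext; have [i ang] := extreme_angular uS ext.
case: (boolP (pure S true u)) => [|pt]; first by case: c; [constructor 2|constructor 3].
case: (boolP (pure S false u)) => [|pf]; first by case: c; [constructor 3|constructor 2].
by constructor 1; apply: angular_low_codegree ang pt pf.
Qed.

(** The points [p] and [q] farthest from the line [a b] on its two sides are extreme; if both are
    pure in the other colour, they have low codegree by [a b]. *)
Lemma pure_extreme S c a b : a \in S -> b \in S -> e c a b ->
  low_codegree S \/ exists h, h \in S /\ pure S c h.
Proof.
move=> aS bS ab; have nab := e_neq ab; have nba : b != a by rewrite eq_sym.
have npa : ~~ pure S (~~ c) a.
  by apply/forall_inPn; exists b => //; rewrite !negbK.
have [p pS hp] := exists_min (orient b a) aS.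
have [q qS hq] := exists_min (orient a b) aS.
have step h : h \in S -> extreme S h ->
    (low_codegree S \/ exists h, h \in S /\ pure S c h) \/ pure S (~~ c) h.
  by move=> hS /(extreme_low_codegree c hS)[]; [left; left|left; right; exists h|right].
have [//|pp] := step p pS (ex_intro _ b (ex_intro _ a (conj nba hp))).
have [//|pq] := step q qS (ex_intro _ a (ex_intro _ b (conj nab hq))).
(* If one side of the line is empty, [a] is extreme itself, and [a b] keeps it from being pure in
   the other colour. *)
have aext : extreme S a -> low_codegree S \/ exists h, h \in S /\ pure S c h.
  by move=> /(step a aS)[//|]; rewrite (negbTE npa).
have := hp a aS; rewrite orient_abb le_eqVlt => /predU1P[p0|p0].
  by apply: aext; exists b, a; split => // x xS; rewrite orient_abb -p0 hp.
have := hq a aS; rewrite orient_aba le_eqVlt => /predU1P[q0|q0].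
  by apply: aext; exists a, b; split => // x xS; rewrite orient_aba -q0 hq.
left; apply: (edge_low_codegree ab pS qS pp pq) q0.
by rewrite orient_baC oppr_gt0.
Qed.

Lemma low_codegree_exists S : (forall c, exists a b, [/\ a \in S, b \in S & e c a b]) ->
  low_codegree S.
Proof.
move=> both; have [a [b [aS bS ab]]] := both true.
have [a' [b' [aS' bS' ab']]] := both false.
have [//|[h [hS ph]]] := pure_extreme aS bS ab.
have [//|[k [kS pk]]] := pure_extreme aS' bS' ab'.
have [E|hk] := eqVneq h k; last exact: pure_low_codegree hk ph pk.
(* [h] is pure in both colours, so it has no neighbours and any second point will do. *)
have [z zS hz] : exists2 z, z \in S & h != z.
  have [E'|ha] := eqVneq h a; last by exists a.
  by exists b; rewrite // E' (e_neq ab).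
apply: (@low_codegreeI _ h z h h) => // w wh.
have := in_nbr_pure ph wh; subst k; have := in_nbr_pure pk wh.
by move=> h1 h2; case: (e_excl h2 h1).
Qed.

(** * Counting coloured pairs *)

Local Open Scope nat_scope.

(* Every edge is counted twice, once from each endpoint. *)
Definition edges (S : {set T}) := \sum_(x in S) #|nbr S x|.

Lemma card_nbr (S : {set T}) x : #|nbr S x| = \sum_(y in S) coloured x y.
Proof.
rewrite -sum1dep_card big_mkcondr; apply: eq_bigr => y _.
by case: (coloured x y).
Qed.

Lemma edges_setD1 S x : x \in S -> edges S = edges (S :\ x) + 2 * #|nbr S x|.
Proof.
move=> xS; rewrite /edges (big_setD1 x xS) /=.
have -> : \sum_(z in S :\ x) #|nbr S z| =
    \sum_(z in S :\ x) #|nbr (S :\ x) z| + #|nbr S x|.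
  rewrite [#|nbr S x|]card_nbr (big_setD1 x xS) /= coloured_irr add0n -big_split /=.
  by apply: eq_bigr => z _; rewrite !card_nbr (big_setD1 x xS) /= addnC coloured_sym.
by clear; lia.
Qed.

Lemma nbr_sub S x : nbr S x \subset S :\ x.
Proof.
apply/fintype.subsetP => y; rewrite !inE => /andP[-> xy]; rewrite andbT.
by apply: contraTneq xy => ->; rewrite coloured_irr.
Qed.

(** The neighbourhoods of [x], and of [y] after deleting [x], both lie in [S :\ x], so their sizes
    add up to at most [#|S| - 1 + 2]. *)
Lemma edges_pair S x y : x \in S -> y \in S -> x != y ->
  #|nbr S x :&: nbr S y| <= 2 ->
  edges S <= edges (S :\ x :\ y) + 2 * #|S|.+1.
Proof.
move=> xS yS xy cod; have yD : y \in S :\ x by rewrite !inE eq_sym xy.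
rewrite (edges_setD1 xS) (edges_setD1 yD) -addnA leq_add2l -mulnDr leq_mul2l /=.
rewrite addnC -cardsUI (cardsD1 x S) xS add1n -addn2 leq_add //.
  apply/subset_leq_card; rewrite subUset nbr_sub /=.
  by apply: fintype.subset_trans (nbr_sub _ _) _; exact: subsetDl.
apply: leq_trans cod; apply/subset_leq_card/setIS/fintype.subsetP => z.
by rewrite !inE => /andP[/andP[_ ->] ->].
Qed.

(** All edges join the two sides of a line, and [#|L| * #|M|] is at most a quarter of the square;
    points on the line have no edges. *)
Lemma edges_bipartite (Q : {set T}) a b :
  (forall x y, x \in Q -> y \in Q -> coloured x y -> (orient a b x * orient a b y < 0)%R) ->
  2 * edges Q <= #|Q| ^ 2.
Proof.
move=> bip; pose L := [set x in Q | (0 < orient a b x)%R].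
pose M := [set x in Q | (orient a b x < 0)%R].
have LM : #|L| + #|M| <= #|Q|.
  rewrite -cardsUI (_ : L :&: M = set0) ?cards0 ?addn0.
    by apply/subset_leq_card/fintype.subsetP => x; rewrite !inE => /orP[]/andP[].
  apply/setP => x; rewrite !inE; apply/negP => /andP[/andP[_ h1] /andP[_ h2]].
  by move: h1; rewrite ltNge ltW.
have deg x : x \in Q -> #|nbr Q x| <= (x \in L) * #|M| + (x \in M) * #|L|.
  move=> xQ; case: (ltgtP (orient a b x) 0%R) => ox.
  - rewrite [x \in M]inE xQ ox mul1n; apply: leq_trans (leq_addl _ _).
    apply/subset_leq_card/fintype.subsetP => y; rewrite !inE => /andP[yQ xy].
    by rewrite yQ; have := bip x y xQ yQ xy; rewrite nmulr_rlt0.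
  - rewrite [x \in L]inE xQ ox mul1n; apply: leq_trans (leq_addr _ _).
    apply/subset_leq_card/fintype.subsetP => y; rewrite !inE => /andP[yQ xy].
    by rewrite yQ; have := bip x y xQ yQ xy; rewrite pmulr_rlt0.
  - rewrite (_ : nbr Q x = set0) ?cards0 //; apply/setP => y; rewrite !inE.
    by apply/negP => /andP[yQ xy]; have := bip x y xQ yQ xy; rewrite ox mul0r ltxx.
have sumI (A : {set T}) k : A \subset Q -> \sum_(x in Q) (x \in A) * k = #|A| * k.
  move=> AQ; rewrite -big_distrl /= -sum1_card big_mkcond [in RHS]big_mkcond /=.
  congr (_ * _); apply: eq_bigr => x _.
  case: ifP => [|xQ]; first by case: (x \in A).
  by case: ifP => // /(fintype.subsetP AQ); rewrite xQ.
have EQ : edges Q <= #|L| * #|M| + #|M| * #|L|.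
  rewrite -!sumI; try by apply/fintype.subsetP => x; rewrite inE => /andP[].
  by rewrite -big_split; apply: leq_sum => x; exact: deg.
apply: leq_trans (_ : (#|L| + #|M|) ^ 2 <= _); last by rewrite leq_exp2r.
have [+ _] := nat_AGM2 #|L| #|M|; move: EQ; rewrite [#|M| * _]mulnC.
by move: (_ ^ 2) (#|L| * _); clear; lia.
Qed.

Lemma edges_max S : edges S <= #|S| * #|S|.-1.
Proof.
rewrite /edges -sum_nat_const; apply: leq_sum => x xS.
by rewrite (cardsD1 x S) xS; apply/subset_leq_card/nbr_sub.
Qed.

(** After the deletion all edges have the other colour, and those avoiding [q] cross the line [p q],
    so they form a bipartite graph. *)
Lemma edges_le_wiped S x y c p q : 5 <= #|S| -> x \in S -> y \in S -> x != y ->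
  #|nbr S x :&: nbr S y| <= 2 -> e c p q -> p \notin S :\ x :\ y ->
  (forall z w, z \in S :\ x :\ y -> w \in S :\ x :\ y -> ~~ e c z w) ->
  2 * edges S + odd #|S| + 8 <= #|S| * #|S| + 4 * #|S|.
Proof.
move=> S5 xS yS xy cod pq pS' wiped; have ES := edges_pair xS yS xy cod.
set S' := S :\ x :\ y in pS' wiped ES.
have cS : #|S| = #|S'|.+2.
  rewrite (cardsD1 x) xS (cardsD1 y (S :\ x)) (_ : y \in S :\ x) //.
  by rewrite !inE eq_sym xy.
have bip (Q : {set T}) : Q \subset S' -> q \notin Q -> 2 * edges Q <= #|Q| ^ 2.
  move=> /fintype.subsetP QS' qQ; apply: (@edges_bipartite _ p q) => z w zQ wQ.
  have zS := QS' z zQ; have wS := QS' w wQ.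
  rewrite (colouredE c) (negbTE (wiped z w zS wS)) /= => zw.
  have np t : t \in S' -> t != p by apply: contraTneq => ->.
  have nq t : t \in Q -> t != q by apply: contraTneq => ->.
  by apply: straddle pq zw _ _ _ _; rewrite ?np ?nq.
have odd1 : odd #|S| <= 1 by case: odd.
case: (boolP (q \in S')) => [qS'|/(bip _ (fintype.subxx _))]; last first.
  by move: S5 ES odd1; rewrite cS; clear; nia.
(* [S' :\ q] has [#|S| - 3] points, and [q] at most that many neighbours in it; the sum fits from 5
   points on, without slack at 5. *)
have := bip (S' :\ q) (subsetDl _ _); rewrite !inE eqxx => /(_ isT).
have := edges_setD1 qS'; have := subset_leq_card (nbr_sub S' q).
by move: S5 ES odd1; rewrite cS (cardsD1 q S') qS'; clear; nia.
Qed.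

(* With [m = #|S| - 2], this says [edges S <= 2 * (2 * m + 1 + m ^ 2 %/ 4)]. *)
Lemma edges_le S : 3 <= #|S| ->
  (forall c, exists a b, [/\ a \in S, b \in S & e c a b]) ->
  2 * edges S + odd #|S| + 8 <= #|S| * #|S| + 4 * #|S|.
Proof.
have [n] := ubnP #|S|; elim: n S => // n IH S Sn S3 both.
have [S5|S5] := ltnP #|S| 5.
  have : #|S| = 3 \/ #|S| = 4 by move: S3 S5; clear; lia.
  (* For 3 and 4 points the bound allows all pairs. *)
  by case=> E; have := edges_max S; rewrite E /=; clear; lia.
have [x [y [xS yS xy cod]]] := low_codegree_exists both.
set S' := S :\ x :\ y.
have cS : #|S| = #|S'|.+2.
  rewrite (cardsD1 x) xS (cardsD1 y (S :\ x)) (_ : y \in S :\ x) //.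
  by rewrite !inE eq_sym xy.
pose left c := [exists z in S', [exists w in S', e c z w]].
case: (boolP [forall c, left c]) => [/forallP lf|/forallPn[c nl]].
  have both' c : exists a b, [/\ a \in S', b \in S' & e c a b].
    by have /exists_inP[z zS' /exists_inP[w wS' zw]] := lf c; exists z, w.
  have S'n : #|S'| < n by move: Sn; rewrite cS ltnS => /ltnW.
  have S'3 : 3 <= #|S'| by move: S5; rewrite cS.
  (* The right-hand side grows by exactly [4 * (#|S| + 1)] from [#|S| - 2] points to [#|S|]; the
     parity stays. *)
  have := edges_pair xS yS xy cod; rewrite -/S'.
  by move: (IH S' S'n S'3 both'); rewrite cS /= negbK; clear; nia.
have wiped z w : z \in S' -> w \in S' -> ~~ e c z w.
  move=> zS' wS'; move: nl; apply: contra => zw.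
  by apply/exists_inP; exists z => //; apply/exists_inP; exists w.
have [p [q [pS qS pq]]] := both c.
case: (boolP (p \in S')) => pS'; last exact: edges_le_wiped pq pS' wiped.
case: (boolP (q \in S')) => qS'; first by rewrite (negbTE (wiped p q _ _)) in pq.
have qp : e c q p by rewrite e_sym.
exact: edges_le_wiped qp qS' wiped.
Qed.

End CodegreeTwo.

From mathcomp Require Import finmap boolp classical_sets reals.

Local Open Scope nat_scope.

(** * Vertex cuts *)

Lemma connectivity_le_min_degree (G : sgraph) :
  0 < #|G| -> connectivity G <= min_degree G.
Proof.
move=> G0; have [v dv] := min_degree_attained G0.
apply/bigmax_leqP => k /andP[_ /forallP kc]; rewrite leqNgt -dv; apply/negP => vk.
(* Without its neighbours [v] is isolated, and some other vertex is left because
   [degree v < k < #|G|]. *)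
pose W := [set u : G | adj v u]%SET.
have vW : v \notin W by rewrite inE adj_irrefl.
have : 0 < #|~: (v |: W)|.
  by rewrite cardsCs finset.setCK cardsU1 vW subn_gt0 (leq_ltn_trans vk).
case/card_gt0P => w; rewrite !inE negb_or => /andP[wv wW].
have {}wW : w \notin W by rewrite inE.
have /implyP/(_ vk)/forallP/(_ (exist _ v vW))/forallP/(_ (exist _ w wW)) := kc W.
case/connectP => -[|[a aW] p] /=; first by move=> _ [E]; rewrite E eqxx in wv.
by move=> /andP[va _] _; move: (aW); rewrite inE; move: va; rewrite /del_adj /= => ->.
Qed.

Lemma delete_disconnectedP (G : sgraph) (W : {set G}) :
  ~~ connected (delete W) -> exists A : bool -> {set G},
    [/\ forall c, exists x, x \in A c,
        forall c x, x \in A c -> x \notin A (~~ c),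
        forall c x y, x \in A c -> y \in A (~~ c) -> ~~ adj x y &
        forall x, [|| x \in A true, x \in A false | x \in W]].
Proof.
case/forallPn => u /forallPn[v uv].
(* [A true] is the component of [u], [A false] the rest. *)
pose A c := val @: [set y : delete W | connect (@adj (delete W)) u y == c].
have AP c x : x \in A c -> exists xW : x \notin W,
    connect (@adj (delete W)) u (exist _ x xW) = c.
  by case/imsetP => -[y yW]; rewrite inE => /eqP h ->; exists yW.
exists A; split.
- case; first by exists (val u); rewrite imset_f // inE connect0.
  by exists (val v); rewrite imset_f // inE (negbTE uv).
- move=> c x /AP[xW h]; apply/negP => /AP[xW' h'].
  have : c = ~~ c by rewrite -h' -h (bool_irrelevance xW xW').
  by case: c {h h'}.
- move=> c x y /AP[xW hx] /AP[yW hy]; apply/negP => xy.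
  have E : connect (@adj (delete W)) u (exist _ x xW) =
           connect (@adj (delete W)) u (exist _ y yW).
    have xy1 : connect (@adj (delete W)) (exist _ x xW) (exist _ y yW) by exact: connect1.
    have yx1 : connect (@adj (delete W)) (exist _ y yW) (exist _ x xW).
      by apply: connect1; rewrite adj_sym.
    by apply/idP/idP => h; [exact: connect_trans h xy1|exact: connect_trans h yx1].
  by move: E; rewrite hx hy; case: c {hx hy}.
- move=> x; case: (boolP (x \in W)) => xW; first by rewrite !orbT.
  pose x' : delete W := exist _ x xW.
  have : x \in A (connect (@adj (delete W)) u x') by apply/imsetP; exists x'; rewrite ?inE.
  by case: connect => ->; rewrite ?orbT.
Qed.

(** * Segments of a point set in general position *)

Section Segments.
Variable R : realType.
Local Notation plane := 'rV[R]_2.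
Local Open Scope ring_scope.
Local Open Scope classical_set_scope.

Lemma segmentC (x y : plane) : segment x y = segment y x.
Proof.
suff sub : forall a b : plane, segment a b `<=` segment b a by apply/seteqP; split; exact: sub.
move=> a b _ [t /= /andP[t0 t1] <-]; exists (1 - t); last by rewrite subKr addrC.
by rewrite /= subr_ge0 t1 lerBlDr lerDl.
Qed.

Lemma segments_separated (al be ga : R) (x y z w : plane) :
  let f (p : plane) := al * p ord0 ord0 + be * p ord0 ord_max + ga in
  f x <= 0 -> f y <= 0 -> 0 < f z -> 0 < f w ->
  segment x y `&` segment z w = set0.
Proof.
move=> f fx fy fz fw; apply/seteqP; split => // _ [[t /= /andP[t0 t1] <-] [s /= /andP[s0 s1]]].
have fE r a b : f ((1 - r) *: a + r *: b) = (1 - r) * f a + r * f b.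
  by rewrite /f !mxE; ring.
move=> /(congr1 f); rewrite !fE.
have : (1 - t) * f x + t * f y <= 0.
  by rewrite -oppr_ge0 opprD -!mulrN addr_ge0 ?mulr_ge0 ?oppr_ge0 ?subr_ge0.
have : 0 < (1 - s) * f z + s * f w.
  case: (ltgtP s 0) s0 => // [s0|->] _; last by rewrite subr0 mul1r mul0r addr0.
  by rewrite ltr_wpDl ?mulr_ge0 ?mulr_gt0 ?subr_ge0 // ltW.
by move=> h1 h2 E; move: h1; rewrite E ltNge h2.
Qed.

Lemma plane_ext (x y : plane) :
  x ord0 ord0 = y ord0 ord0 -> x ord0 ord_max = y ord0 ord_max -> x = y.
Proof.
move=> h0 h1; apply/rowP => -[[|[|//]] h].
  by rewrite (_ : Ordinal h = ord0) //; apply: val_inj.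
by rewrite (_ : Ordinal h = ord_max) //; apply: val_inj.
Qed.

Lemma collinearP (a b c : plane) : a != b ->
  (b ord0 ord0 - a ord0 ord0) * (c ord0 ord_max - a ord0 ord_max)
  - (b ord0 ord_max - a ord0 ord_max) * (c ord0 ord0 - a ord0 ord0) = 0 ->
  collinear a b c.
Proof.
move=> ab o0; exists a, (b - a); split.
- by rewrite subr_eq0 eq_sym.
- by exists 0; rewrite // scale0r addr0.
- by exists 1; rewrite // scale1r addrC subrK.
have [E|n0] := eqVneq (b ord0 ord0) (a ord0 ord0).
  have n1 : b ord0 ord_max - a ord0 ord_max != 0.
    by rewrite subr_eq0; apply: contra_neq ab => E1; apply: plane_ext.
  exists ((c ord0 ord_max - a ord0 ord_max) / (b ord0 ord_max - a ord0 ord_max)) => //.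
  move: o0; rewrite E subrr mul0r sub0r => /eqP.
  rewrite oppr_eq0 mulf_eq0 (negbTE n1) subr_eq0 /= => /eqP E'.
  apply: plane_ext; rewrite !mxE; first by rewrite E E' subrr mulr0 addr0.
  by rewrite divfK // addrC subrK.
rewrite -subr_eq0 in n0.
exists ((c ord0 ord0 - a ord0 ord0) / (b ord0 ord0 - a ord0 ord0)) => //.
apply: plane_ext; rewrite !mxE; first by rewrite divfK // addrC subrK.
move: o0 => /eqP; rewrite subr_eq0 => /eqP E.
by rewrite mulrAC [_ * (b _ _ - a _ _)]mulrC -E [_ * (c _ _ - _)]mulrC mulfK // addrC subrK.
Qed.

Lemma segment_collinear (x y z : plane) : x != y -> segment x y z -> collinear x y z.
Proof.
move=> xy [t _ <-]; exists x, (y - x); split.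
- by rewrite subr_eq0 eq_sym.
- by exists 0; rewrite // scale0r addr0.
- by exists 1; rewrite // scale1r addrC subrK.
- by exists t; rewrite // scalerBr scalerBl scale1r addrA addrAC.
Qed.

Variable P : {fset plane}.
Hypothesis genP : general_position P.
Local Notation G := (edge_disjointness_graph P).

(** In general position a segment contains no points of [P] but its ends, so the set of its points
    determines them. *)
Lemma segment_inj (x y z w : P) : x != y -> z != w ->
  segment (val x) (val y) = segment (val z) (val w) ->
  (x == z) && (y == w) || (x == w) && (y == z).
Proof.
have inseg (a b c : P) : a != b -> segment (val a) (val b) (val c) -> (c == a) || (c == b).
  move=> ab abc; apply: contraT; rewrite negb_or => /andP[ca cb].
  have := genP (fsvalP a) (fsvalP b) (fsvalP c); rewrite -!val_eqE in ab ca cb *.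
  rewrite ab eq_sym ca eq_sym cb => /(_ isT isT isT) []; exact: segment_collinear.
move=> xy zw E.
have xin : (x == z) || (x == w) by apply: inseg zw _; rewrite -E; exact: segment_left.
have yin : (y == z) || (y == w).
  by apply: inseg zw _; rewrite -E segmentC; exact: segment_left.
case/orP: xin yin => /eqP Ex /orP[] /eqP Ey; move: xy; rewrite Ex Ey !eqxx ?orbT //.
Qed.

Lemma segments_vertex (x y : P) : x != y ->
  exists s : G, val s = segment (val x) (val y).
Proof.
move=> xy.
have sP : segment (val x) (val y) \in segments P.
  by apply: in_imfset2; rewrite ?inE ?fsvalP.
by exists [` sP]%fset.
Qed.

Lemma vertex_segment (s : G) :
  exists x y : P, x != y /\ val s = segment (val x) (val y).
Proof.
have /imfset2P[x xP [y]] := fsvalP s; rewrite !inE => /andP[yP xy] E.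
by exists [` xP]%fset, [` yP]%fset.
Qed.

Definition in_class (A : {set G}) (x y : P) : bool :=
  (x != y) && [exists s in A, val s == segment (val x) (val y)].

Lemma in_classP (A : {set G}) x y :
  reflect (x != y /\ exists2 s : G, s \in A & val s = segment (val x) (val y))
          (in_class A x y).
Proof.
apply: (iffP andP) => -[xy h]; split=> //.
  by case/exists_inP: h => s sA /eqP; exists s.
by case: h => s sA h; apply/exists_inP; exists s => //; apply/eqP.
Qed.

Local Open Scope nat_scope.

(** A vertex of the separator thus costs at most two ordered pairs. *)
Lemma segment_pairs_le2 (s : G) :
  \sum_(x : P) \sum_(y : P) ((x != y) && (val s == segment (val x) (val y))) <= 2.
Proof.
rewrite pair_big /=.
pose C := [set p : P * P | (p.1 != p.2) && (val s == segment (val p.1) (val p.2))]%SET.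
have -> : \sum_(p : P * P) ((p.1 != p.2) && (val s == segment (val p.1) (val p.2))) = #|C|.
  by rewrite -sum1dep_card [RHS]big_mkcond; apply: eq_bigr => p _; case: (_ && _).
have [x [y [xy E]]] := vertex_segment s.
apply: leq_trans (_ : #|[set (x, y); (y, x)]%SET| <= 2); last by rewrite cards2; case: eqP.
apply/subset_leq_card/fintype.subsetP => -[z w]; rewrite !inE /= => /andP[zw /eqP E'].
have := segment_inj zw xy; rewrite -E -E' => /(_ erefl).
by case/orP => /andP[/eqP -> /eqP ->]; rewrite eqxx ?orbT.
Qed.

(** Each of the [n * (n - 1)] ordered pairs is coloured or spans a segment of [W], and [edges_le]
    bounds the coloured ones. *)
Lemma separator_card (W : {set G}) : 3 <= #|` P|%fset ->
  ~~ connected (delete W) ->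
  #|` P|%fset ^ 2 + 8 + odd #|` P|%fset <= 4 * #|W| + 6 * #|` P|%fset.
Proof.
move=> P3 /delete_disconnectedP[A [A0 A_excl A_adj A_cover]].
pose n := #|{: P}|; have nE : n = #|` P|%fset by rewrite /n cardfE.
rewrite -nE in P3 *.
pose px (x : P) := val x ord0 ord0; pose py (x : P) := val x ord0 ord_max.
pose e c := in_class (A c).
have pt_inj a b : px a = px b -> py a = py b -> a = b.
  by move=> h0 h1; apply/val_inj/plane_ext.
have gen_pos a b c : a != b -> a != c -> b != c -> orient px py a b c != 0%R.
  move=> ab ac bc; apply/eqP => o0.
  apply: (genP (fsvalP a) (fsvalP b) (fsvalP c)) => //.
  by apply: collinearP o0; rewrite val_eqE.
have e_sym c : symmetric (e c).
  by move=> x y; rewrite /e /in_class eq_sym segmentC.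
have e_irr c : irreflexive (e c) by move=> x; rewrite /e /in_class eqxx.
have e_excl c x y : e c x y -> e (~~ c) x y -> False.
  move=> /in_classP[_ [s sA Es]] /in_classP[_ [t tA Et]].
  have st : s = t by apply: val_inj; rewrite Es Et.
  by have := A_excl c s sA; rewrite st tA.
have e_sep c a b x y z w : e c x y -> e (~~ c) z w -> a != b ->
    (orient px py a b x <= 0 -> orient px py a b y <= 0 ->
     0 < orient px py a b z -> 0 < orient px py a b w -> False)%R.
  move=> /in_classP[_ [s sA Es]] /in_classP[_ [t tA Et]] _ ox oy oz ow.
  have := A_adj c s t sA tA => /negP; apply; apply/asboolP; rewrite Es Et.
  (* [orient a b] as an affine function of the coordinates. *)
  pose al := (- (py b - py a))%R; pose be := (px b - px a)%R.
  pose ga := (- (al * px a + be * py a))%R.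
  have oE p : orient px py a b p = (al * px p + be * py p + ga)%R.
    by rewrite /orient /ga /be /al; ring.
  by apply: (@segments_separated al be ga); rewrite -?oE.
have both c : exists a b, [/\ a \in [set: P]%SET, b \in [set: P]%SET & e c a b].
  have [s sA] := A0 c; have [x [y [xy E]]] := vertex_segment s.
  by exists x, y; split; rewrite ?inE //; apply/in_classP; split=> //; exists s.
have := edges_le pt_inj gen_pos e_sym e_irr e_excl e_sep (S := [set: P]%SET).
rewrite cardsT => /(_ P3 both).
have : n * n.-1 <= edges e [set: P]%SET + #|W| * 2.
  have -> : n * n.-1 = \sum_(x : P) \sum_(y : P) (x != y).
    rewrite -sum_nat_const; apply: eq_bigr => x _.
    rewrite -(cardC1 x) -sum1_card big_mkcond; apply: eq_bigr => y _.
    by rewrite !inE eq_sym; case: eqP.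
  have -> : edges e [set: P]%SET = \sum_(x : P) \sum_(y : P) coloured e x y.
    rewrite /edges; apply: eq_big => [x|x _]; first by rewrite inE.
    by rewrite card_nbr; apply: eq_bigl => y; rewrite inE.
  apply: leq_trans (_ : \sum_(x : P) \sum_(y : P) coloured e x y +
      \sum_(s in W) \sum_(x : P) \sum_(y : P)
      ((x != y) && (val s == segment (val x) (val y))) <= _); last first.
    by rewrite leq_add2l -sum_nat_const; apply: leq_sum => s _; exact: segment_pairs_le2.
  rewrite [X in _ + X]exchange_big -big_split /=; apply: leq_sum => x _.
  rewrite [X in _ + X]exchange_big -big_split /=; apply: leq_sum => y _.
  case: eqVneq => //= xy; have [s Es] := segments_vertex xy.
  have inA c : s \in A c -> e c x y by move=> sA; apply/in_classP; split=> //; exists s.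
  case/or3P: (A_cover s) => [/inA h|/inA h|sW].
  - by rewrite /coloured h.
  - by rewrite /coloured h orbT.
  - by rewrite (bigD1 s) //= Es eqxx addnCA.
by rewrite -/n; move: P3; clear; nia.
Qed.

End Segments.

(** * Binomial bound and conclusion *)

(** The sum of binomials is [((n - 2) * (n - 4) + odd n) / 4], put in the form of the separator
    bound. *)
Lemma bin_halves n : 3 <= n -> n ^ 2 + 8 + odd n =
  4 * ('C((n - 2)./2, 2) + 'C(uphalf (n - 2), 2)) + 6 * n.
Proof.
have E k : 'C(k, 2) * 2 = k * k.-1.
  by have := bin_ffact k 2; rewrite ffactnS ffactn1.
case: n => [|[|[|m]]] // _; rewrite subn2 /= negbK uphalf_half.
have := E m./2; have := E m./2.+1; have := odd_double_half m.
by case: odd => /=; rewrite ?add0n ?add1n -?muln2; clear; nia.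
Qed.

Theorem corollary1 (R : realType) (n : nat) (P : {fset 'rV[R]_2}) :
  3 <= n -> #|` P|%fset = n -> general_position P ->
  min_degree (edge_disjointness_graph P) =
    'C((n - 2)./2, 2) + 'C(uphalf (n - 2), 2) ->
  connectivity (edge_disjointness_graph P) =
    'C((n - 2)./2, 2) + 'C(uphalf (n - 2), 2).
Proof.
move=> n3 Pn genP; set b := _ + _ => deg.
have G0 : 0 < #|edge_disjointness_graph P|.
  have : 1 < #|{: P}| by rewrite -cardfE Pn ltnW.
  case/card_gt1P => x [y [_ _ xy]]; have [s _] := segments_vertex xy.
  by apply/card_gt0P; exists s.
apply/eqP; rewrite eqn_leq -{1}deg connectivity_le_min_degree //=.
apply: k_connected_le; apply/andP; split.
  (* [b] is the degree of a vertex, hence less than the number of vertices. *)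
  have [v dv] := min_degree_attained G0; rewrite -deg -dv /degree -cardsT.
  apply/proper_card/properP; split; first exact: finset.subsetT.
  by exists v; rewrite ?inE ?adj_irrefl.
apply/forallP => W; apply/implyP; apply: contraLR => /(separator_card genP).
rewrite Pn -leqNgt => /(_ n3); rewrite bin_halves // leq_add2r leq_mul2l //.
Qed.
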